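(* Let $G$ and $H$ be object-separated Lie groupoids which are Morita-equivalent. If $G$ is compactly generated, then $H$ is compactly generated.
   Context: Manifolds are smooth and finite-dimensional, and are not assumed Hausdorff unless explicitly stated. ''Compact'' means that every open cover has a finite subcover (no Hausdorff condition). ''Relatively compact'' means contained in some compact subset (of the ambient space). A groupoid $G$ is a small category in which every arrow is invertible; $G_0$ is its set of objects (the base), $G$ (also $G_1$) its set of arrows, $s,t:G\to G_0$ the source and target maps, and arrows $g:x\to y$, $h:y\to z$ compose to $hg:x\to z$. $G_0$ is identified with the set of units in $G$. A Lie groupoid is a groupoid $G$ such that $G$ and $G_0$ are manifolds, $s,t$ are submersions, and the product, inverse and unit maps are smooth. A Lie groupoid is object-separated if its base is Hausdorff. A Lie groupoid morphism is a smooth functor $\phi:G\to H$ between Lie groupoids; $\phi_0:G_0\to H_0$ is the induced map on bases. Given a Lie groupoid $H$ and a smooth map $f:M\to H_0$ such that $t\circ\pi_H: H\times_{s,f}M=\{(h,m): s(h)=f(m)\}\to H_0$, $(h,m)\mapsto t(h)$, is a submersion, the pullback groupoid $f^*H$ is the Lie groupoid with base $M$ and arrow manifold $\{(n,h,m)\in M\times H\times M: t(h)=f(n),\ s(h)=f(m)\}$, source $m$, target $n$, and product $(p,h',n)(n,h,m)=(p,h'h,m)$. A Lie groupoid morphism $\phi:G\to H$ is an essential equivalence if $t\circ\pi_H:H\times_{s,\phi_0}G_0\to H_0$ is a surjective submersion and $(t,\phi,s):G\to\phi_0^*H$ is an isomorphism of Lie groupoids. Lie groupoids $G,H$ are Morita-equivalent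 if there exist a Lie groupoid $K$ and essential equivalences $K\to G$ and $K\to H$. Compact generation: for a subset $S\subset G$, $\langle S\rangle$ denotes the subgroupoid generated by $S$ (the intersection of all subsets of $G$ containing $S$ and closed under composition and inversion), and $S_0=s(S)\cup t(S)$ is its base. $S$ generates a full subgroupoid if $\langle S\rangle$ contains every arrow of $G$ whose source and target both lie in $S_0$. The $0$-orbit of $x\in G_0$ is $t(s^{-1}(x))$. $S$ is exhaustive in $G$ if $S_0$ meets every $0$-orbit of $G$. An object-separated Lie groupoid $G$ is compactly generated if it contains an open subset $\mathcal U\subset G$ which is relatively compact in $G$, exhaustive in $G$, and generates a full subgroupoid. *)

(* Defs.v *)
From HB Require Import structures.
From mathcomp Require Import all_boot all_order all_algebra.
From mathcomp Require Import all_classical all_reals all_analysis.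

Set Implicit Arguments.
Unset Strict Implicit.
Unset Printing Implicit Defensive.

Import Order.TTheory GRing.Theory Num.Theory.
Import numFieldNormedType.Exports.

Local Open Scope classical_set_scope.
Local Open Scope ring_scope.

Section Smooth.
Context {R : realType}.

(* [U] is meant to be open. Requiring [x |-> 'd f x v] to be C^k for each [v] is
   the usual condition on [x |-> 'd f x], as [V] will be finite-dimensional. *)
Fixpoint Ck {V W : normedModType R} (k : nat) (U : set V) (f : V -> W) : Prop :=
  match k with
  | 0 => forall x, U x -> {for x, continuous f}
  | k'.+1 => (forall x, U x -> differentiable f x) /\
             (forall v, Ck k' U (fun x => 'd f x v))
  end.

Definition smooth_on {V W : normedModType R} (U : set V) (f : V -> W) : Prop :=
  forall k, Ck k U f.

Section SmoothTheory.
Implicit Types V W : normedModType R.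

Lemma near_eq_diff V W (f g : V -> W) x :
  (\forall y \near x, f y = g y) -> differentiable f x ->
  differentiable g x /\ 'd g x = 'd f x :> (V -> W).
Proof.
move=> fg df; have [dc dfx] := (diff_locallyP x f).1 df.
set L : {linear V -> W} := 'd f x in dc dfx *.
have dgx : g \o shift x = cst (g x) + L +o_ 0 id.
  apply/eqaddoP => e e0; have /eqaddoP/(_ e e0) := dfx.
  move: (fg); rewrite (near_shift 0 x) subr0; apply: filterS2 => y /= fgy.
  rewrite !fctE /= -(nbhs_singleton fg) -fgy => h; exact: h.
have dgE : 'd g x = L :> (V -> W) by exact: diff_unique dc dgx.
split; last exact: dgE.
by apply/diff_locallyP; rewrite dgE; split; [exact: dc|exact: dgx].
Qed.

Lemma Ck_ext V W k (U : set V) (f g : V -> W) :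
  open U -> (forall x, U x -> f x = g x) -> Ck k U f -> Ck k U g.
Proof.
move=> oU; elim: k f g => [|k IH] f g fg /=.
  move=> cf x Ux; have := cf x Ux; rewrite /prop_for /continuous_at (fg _ Ux).
  apply: cvg_trans; apply: near_eq_cvg.
  by apply: filterS (open_nbhs_nbhs (conj oU Ux)) => y /fg.
have nfg x : U x -> \forall y \near x, f y = g y.
  by move=> Ux; apply: filterS (open_nbhs_nbhs (conj oU Ux)) => y /fg.
move=> [df ckf]; split=> [x Ux|v].
  by have [] := near_eq_diff (nfg _ Ux) (df x Ux).
apply: IH (ckf v) => x Ux.
by have [_ ->] := near_eq_diff (nfg _ Ux) (df x Ux).
Qed.

Lemma Ck_sub V W k (U U' : set V) (f : V -> W) :
  U' `<=` U -> Ck k U f -> Ck k U' f.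
Proof.
move=> sU; elim: k f => [|k IH] f /= => [cf x /sU|[df cf]]; first exact: cf.
by split=> [x /sU|v]; [exact: df|exact/IH/cf].
Qed.

Lemma CkD V W k (U : set V) (f g : V -> W) :
  open U -> Ck k U f -> Ck k U g -> Ck k U (f + g).
Proof.
move=> oU; elim: k f g => [|k IH] f g /=.
  by move=> cf cg x Ux; apply: cvgD; [exact: cf|exact: cg].
move=> [df cf] [dg cg]; split=> [x Ux|v].
  by apply: differentiableD; [exact: df|exact: dg].
apply: (Ck_ext oU _ (IH _ _ (cf v) (cg v))) => x Ux.
by rewrite (diffD (df x Ux) (dg x Ux)).
Qed.

Lemma Ck_linl V W W' k (U : set V) (f : V -> W) (L : {linear W -> W'}) :
  continuous L -> open U -> Ck k U f -> Ck k U (L \o f).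
Proof.
move=> cL oU; elim: k f => [|k IH] f /=.
  by move=> cf x Ux; apply: continuous_comp; [exact: cf|exact: cL].
move=> [df cf]; split=> [x Ux|v].
  by apply: differentiable_comp; [exact: df|exact: linear_differentiable].
apply: (Ck_ext oU _ (IH _ (cf v))) => x Ux.
rewrite diff_comp; [|exact: df|exact: linear_differentiable].
by rewrite /= diff_lin.
Qed.

Lemma Ck_linr V V' W k (U : set V') (f : V' -> W) (L : {linear V -> V'}) :
  continuous L -> open U -> Ck k U f -> Ck k (L @^-1` U) (f \o L).
Proof.
move=> cL oU; have oLU : open (L @^-1` U).
  by apply: open_comp oU => x _; exact: cL.
elim: k f => [|k IH] f /=.
  by move=> cf x Ux; apply: continuous_comp; [exact: cL|exact: cf].
move=> [df cf]; split=> [x Ux|v].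
  by apply: differentiable_comp; [exact: linear_differentiable|exact: df].
apply: (Ck_ext oLU _ (IH _ (cf (L v)))) => x Ux.
rewrite diff_comp; [|exact: linear_differentiable|exact: df].
by rewrite /= diff_lin.
Qed.

Lemma continuous_row_mx m n (T : topologicalType) (f : T -> 'rV[R]_m)
    (g : T -> 'rV[R]_n) (x : T) :
  {for x, continuous f} -> {for x, continuous g} ->
  {for x, continuous (fun y => row_mx (f y) (g y))}.
Proof.
move=> cf cg A /nbhs_ballP[e /= e0 eA].
have nf : \forall y \near x, ball (f x) e (f y).
  by apply: cf; exact: nbhsx_ballx.
have ng : \forall y \near x, ball (g x) e (g y).
  by apply: cg; exact: nbhsx_ballx.
suff nA : \forall y \near x, A (row_mx (f y) (g y)) by exact: nA.
near=> y; apply: eA; split=> // i j.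
have [_ fy] : ball (f x) e (f y) by near: y.
have [_ gy] : ball (g x) e (g y) by near: y.
by rewrite !mxE; case: splitP => k _; [exact: fy|exact: gy].
Unshelve. all: by end_near. Qed.

Lemma smooth_on_row_mx m n m' n' (U : set 'rV[R]_m) (V : set 'rV[R]_n)
    (f : 'rV[R]_m -> 'rV[R]_m') (g : 'rV[R]_n -> 'rV[R]_n') :
  open U -> open V -> smooth_on U f -> smooth_on V g ->
  smooth_on [set z : 'rV[R]_(m + n) | U (lsubmx z) /\ V (rsubmx z)]
    (fun z => row_mx (f (lsubmx z)) (g (rsubmx z))).
Proof.
move=> oU oV sf sg k; set UV := [set z | _].
have oL : open (lsubmx @^-1` U : set 'rV[R]_(m + n)).
  by apply: open_comp oU => x _; exact: continuous_lsubmx.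
have oR : open (rsubmx @^-1` V : set 'rV[R]_(m + n)).
  by apply: open_comp oV => x _; exact: continuous_rsubmx.
have oUV : open UV by exact: openI.
pose il := mulmxr (row_mx 1%:M 0) : 'rV[R]_m' -> 'rV[R]_(m' + n').
pose ir := mulmxr (row_mx 0 1%:M) : 'rV[R]_n' -> 'rV[R]_(m' + n').
have ilE u : il u = row_mx u 0 by rewrite /il /= mul_mx_row mulmx1 mulmx0.
have irE u : ir u = row_mx 0 u by rewrite /ir /= mul_mx_row mulmx1 mulmx0.
have cil : continuous il.
  rewrite (_ : il = fun u => row_mx u 0); last exact/funext.
  move=> u; apply: (@continuous_row_mx _ _ 'rV[R]_m' id (fun=> 0));
    [move=> B; exact|exact: cst_continuous].
have cir : continuous ir.
  rewrite (_ : ir = fun u => row_mx 0 u); last exact/funext.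
  move=> u; apply: (@continuous_row_mx _ _ 'rV[R]_n' (fun=> 0) id);
    [exact: cst_continuous|move=> B; exact].
have Ckl : Ck k UV (il \o (f \o lsubmx)).
  apply: (Ck_linl cil oUV).
  have := Ck_linr (L := lsubmx) (@continuous_lsubmx R 1 m n) oU (sf k).
  by apply: Ck_sub => z [].
have Ckr : Ck k UV (ir \o (g \o rsubmx)).
  apply: (Ck_linl cir oUV).
  have := Ck_linr (L := rsubmx) (@continuous_rsubmx R 1 m n) oV (sg k).
  by apply: Ck_sub => z [].
apply: (Ck_ext oUV _ (CkD oUV Ckl Ckr)) => z _.
by rewrite !fctE /= ilE irE add_row_mx addr0 add0r.
Qed.

End SmoothTheory.
End Smooth.

(* A homeomorphism from the open set [chart_dom] onto the open set [chart_cod];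
   [chart_map] and [chart_inv] are total functions with arbitrary values
   elsewhere. The dimension may depend on the chart, hence a manifold need not
   be equidimensional. *)
Record chart (R : realType) (T : topologicalType) := Chart {
  chart_dim : nat;
  chart_dom : set T;
  chart_cod : set 'rV[R]_chart_dim;
  chart_map : T -> 'rV[R]_chart_dim;
  chart_inv : 'rV[R]_chart_dim -> T;
  open_chart_dom : open chart_dom;
  open_chart_cod : open chart_cod;
  chart_map_cod : forall x, chart_dom x -> chart_cod (chart_map x);
  chart_inv_dom : forall y, chart_cod y -> chart_dom (chart_inv y);
  chart_mapK : forall x, chart_dom x -> chart_inv (chart_map x) = x;
  chart_invK : forall y, chart_cod y -> chart_map (chart_inv y) = y;
  chart_map_continuous : forall x, chart_dom x -> {for x, continuous chart_map};
  chart_inv_continuous : forall y, chart_cod y -> {for y, continuous chart_inv}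
}.

Arguments chart_cod {R T} c _.
Arguments chart_inv {R T} c _.

Definition local_rep (R : realType) (S T : topologicalType)
    (c : chart R S) (d : chart R T) (f : S -> T) :
    'rV[R]_(chart_dim c) -> 'rV[R]_(chart_dim d) :=
  chart_map d \o f \o chart_inv c.

Definition local_rep_dom (R : realType) (S T : topologicalType)
    (c : chart R S) (d : chart R T) (f : S -> T) : set 'rV[R]_(chart_dim c) :=
  [set y | chart_cod c y /\ chart_dom d (f (chart_inv c y))].

Arguments local_rep {R S T} c d f _.
Arguments local_rep_dom {R S T} c d f _.

(* The atlas is not required to be maximal. *)
Record smooth_structure (R : realType) (T : topologicalType) := SmoothStructure {
  atlas : set (chart R T);
  atlas_cover : forall x : T, exists2 c, atlas c & chart_dom c x;
  atlas_compat : forall c d, atlas c -> atlas d ->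
    smooth_on (local_rep_dom c d id) (local_rep c d id)
}.

Record manifold (R : realType) := Manifold {
  manifold_sort :> topologicalType;
  manifold_structure : smooth_structure R manifold_sort
}.

Definition charts (R : realType) (M : manifold R) : set (chart R M) :=
  atlas (manifold_structure M).

Section SmoothMaps.
Context {R : realType}.
Implicit Types M N : manifold R.

Definition smooth M N (f : M -> N) : Prop :=
  continuous f /\
  forall c d, charts c -> charts d ->
    smooth_on (local_rep_dom c d f) (local_rep c d f).

Definition submersion M N (f : M -> N) : Prop :=
  smooth f /\
  forall c d x, charts c -> charts d -> chart_dom c x -> chart_dom d (f x) ->
    forall w, exists v, 'd (local_rep c d f) (chart_map c x) v = w.

Definition immersion M N (f : M -> N) : Prop :=
  smooth f /\
  forall c d x, charts c -> charts d -> chart_dom c x -> chart_dom d (f x) ->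
    injective ('d (local_rep c d f) (chart_map c x)).

Definition surjective_submersion M N (f : M -> N) : Prop :=
  submersion f /\ forall y, exists x, f x = y.

End SmoothMaps.

Section ProductManifold.
Context {R : realType}.

Section ProductChart.
Context {S T : topologicalType} (c : chart R S) (d : chart R T).
Local Notation m := (chart_dim c).
Local Notation n := (chart_dim d).

Definition prod_chart_dom : set (S * T) :=
  [set p | chart_dom c p.1 /\ chart_dom d p.2].
Definition prod_chart_cod : set 'rV[R]_(m + n) :=
  [set z | chart_cod c (lsubmx z) /\ chart_cod d (rsubmx z)].
Definition prod_chart_map (p : S * T) : 'rV[R]_(m + n) :=
  row_mx (chart_map c p.1) (chart_map d p.2).
Definition prod_chart_inv (z : 'rV[R]_(m + n)) : S * T :=
  (chart_inv c (lsubmx z), chart_inv d (rsubmx z)).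

Fact open_prod_chart_dom : open prod_chart_dom.
Proof.
apply: openI.
  apply: (@open_comp _ _ (fst : S * T -> S)); last exact: open_chart_dom.
  by move=> p _; exact: cvg_fst.
apply: (@open_comp _ _ (snd : S * T -> T)); last exact: open_chart_dom.
by move=> p _; exact: cvg_snd.
Qed.

Fact open_prod_chart_cod : open prod_chart_cod.
Proof.
apply: openI.
  apply: (@open_comp _ _ (lsubmx : 'rV[R]_(m + n) -> _)); last exact: open_chart_cod.
  by move=> x _; exact: continuous_lsubmx.
apply: (@open_comp _ _ (rsubmx : 'rV[R]_(m + n) -> _)); last exact: open_chart_cod.
by move=> x _; exact: continuous_rsubmx.
Qed.

Fact prod_chart_map_cod p :
  prod_chart_dom p -> prod_chart_cod (prod_chart_map p).
Proof.
move=> [cp dp]; split; rewrite /prod_chart_map /= ?row_mxKl ?row_mxKr;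
  exact: chart_map_cod.
Qed.

Fact prod_chart_inv_dom z :
  prod_chart_cod z -> prod_chart_dom (prod_chart_inv z).
Proof. by move=> [cz dz]; split; exact: chart_inv_dom. Qed.

Fact prod_chart_mapK p :
  prod_chart_dom p -> prod_chart_inv (prod_chart_map p) = p.
Proof.
case: p => x y [/= cx dy]; rewrite /prod_chart_inv row_mxKl row_mxKr.
by rewrite !chart_mapK.
Qed.

Fact prod_chart_invK z :
  prod_chart_cod z -> prod_chart_map (prod_chart_inv z) = z.
Proof.
by move=> [cz dz]; rewrite /prod_chart_map /= !chart_invK // hsubmxK.
Qed.

Fact prod_chart_map_continuous p :
  prod_chart_dom p -> {for p, continuous prod_chart_map}.
Proof.
move=> [cp dp]; apply: continuous_row_mx.
  apply: (@continuous_comp _ _ _ (fst : S * T -> S)); first exact: cvg_fst.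
  exact: chart_map_continuous.
apply: (@continuous_comp _ _ _ (snd : S * T -> T)); first exact: cvg_snd.
exact: chart_map_continuous.
Qed.

Fact prod_chart_inv_continuous z :
  prod_chart_cod z -> {for z, continuous prod_chart_inv}.
Proof.
move=> [cz dz]; apply: cvg_pair; first exact: nbhs_filter.
  have cl := @continuous_lsubmx R 1 m n z.
  exact: (cvg_comp _ _ cl (chart_inv_continuous cz)).
have cr := @continuous_rsubmx R 1 m n z.
exact: (cvg_comp _ _ cr (chart_inv_continuous dz)).
Qed.

Definition prod_chart : chart R (S * T)%type :=
  Chart open_prod_chart_dom open_prod_chart_cod
    prod_chart_map_cod prod_chart_inv_dom prod_chart_mapK prod_chart_invK
    prod_chart_map_continuous prod_chart_inv_continuous.

End ProductChart.

Lemma open_local_rep_dom (S T : topologicalType) (c : chart R S)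
    (d : chart R T) (f : S -> T) :
  continuous f -> open (local_rep_dom c d f).
Proof.
move=> cf; rewrite openE => y [cy dy].
have nc : nbhs y (chart_cod c) 
    by apply: open_nbhs_nbhs; split; [exact: open_chart_cod|exact: cy].
have nd : nbhs y (chart_inv c @^-1` (f @^-1` chart_dom d)).
  apply: (chart_inv_continuous cy); apply: (cf (chart_inv c y)).
  by apply: open_nbhs_nbhs; split; [exact: open_chart_dom|exact: dy].
exact: filterI.
Qed.

Section ProductStructure.
Context (M N : manifold R).

Definition prod_atlas : set (chart R (M * N)%type) :=
  [set e | exists c d, [/\ charts c, charts d & e = prod_chart c d]].

Fact prod_atlas_cover (p : M * N) : exists2 e, prod_atlas e & chart_dom e p.
Proof.
have [c Mc cp] := atlas_cover (manifold_structure M) p.1.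
have [d Nd dp] := atlas_cover (manifold_structure N) p.2.
by exists (prod_chart c d); [exists c, d|].
Qed.

Fact prod_atlas_compat e e' : prod_atlas e -> prod_atlas e' ->
  smooth_on (local_rep_dom e e' id) (local_rep e e' id).
Proof.
move=> [c [d [Mc Nd ->]]] [c' [d' [Mc' Nd' ->]]].
rewrite [X in smooth_on X](_ : _ =
    [set z : 'rV_(chart_dim c + chart_dim d) |
      local_rep_dom c c' id (lsubmx z) /\ local_rep_dom d d' id (rsubmx z)]).
  have cid (T : topologicalType) : continuous (id : T -> T) by move=> x B; exact.
  apply: (smooth_on_row_mx (f := local_rep c c' id) (g := local_rep d d' id)).
  - exact/open_local_rep_dom/cid.
  - exact/open_local_rep_dom/cid.
  - exact: (atlas_compat Mc Mc').
  - exact: (atlas_compat Nd Nd').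
by apply/seteqP; split=> z /= [[? ?] [? ?]].
Qed.

Definition prod_manifold : manifold R :=
  Manifold (SmoothStructure prod_atlas_cover prod_atlas_compat).

End ProductStructure.
End ProductManifold.

(* An embedded submanifold of [M] with underlying set [S]. The type [set_type S]
   carries the subspace topology, so the inclusion, being an immersion, is a
   smooth embedding; as is well known, such a smooth structure on [S] is unique
   (up to equivalence of atlases) when it exists. *)
Record submanifold (R : realType) (M : manifold R) (S : set M) := Submanifold {
  submanifold_structure : smooth_structure R (set_type S);
  submanifold_immersion :
    @immersion R (Manifold submanifold_structure) M set_val
}.

Definition submanifold_manifold (R : realType) (M : manifold R) (S : set M)
    (P : submanifold S) : manifold R :=
  Manifold (submanifold_structure P).
Coercion submanifold_manifold : submanifold >-> manifold.

Definition fibre_product (R : realType) (M N B : manifold R)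
    (f : M -> B) (g : N -> B) : set (prod_manifold M N) :=
  [set p | f p.1 = g p.2].

(* [gmul h g] is the composite of [g] followed by [h]; it is total, but only
   meaningful when [src h = tgt g]. No smoothness is assumed at this stage. *)
Record groupoid (R : realType) := Groupoid {
  obj : manifold R;
  arr : manifold R;
  src : arr -> obj;
  tgt : arr -> obj;
  gunit : obj -> arr;
  ginv : arr -> arr;
  gmul : arr -> arr -> arr;
  src_unit : forall x, src (gunit x) = x;
  tgt_unit : forall x, tgt (gunit x) = x;
  src_inv : forall g, src (ginv g) = tgt g;
  tgt_inv : forall g, tgt (ginv g) = src g;
  src_mul : forall h g, src h = tgt g -> src (gmul h g) = src g;
  tgt_mul : forall h g, src h = tgt g -> tgt (gmul h g) = tgt h;
  gmulA : forall k h g, src k = tgt h -> src h = tgt g ->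
    gmul k (gmul h g) = gmul (gmul k h) g;
  gmul1 : forall g, gmul g (gunit (src g)) = g;
  gmul_unit : forall g, gmul (gunit (tgt g)) g = g;
  gmulV : forall g, gmul g (ginv g) = gunit (tgt g);
  gmulVl : forall g, gmul (ginv g) g = gunit (src g)
}.

Section LieGroupoids.
Context {R : realType}.
Implicit Types G H K : groupoid R.

Definition composable G : set (prod_manifold (arr G) (arr G)) :=
  fibre_product (@src R G) (@tgt R G).

Arguments composable G _ : clear implicits.

(* The submanifold structure on the composable pairs exists as soon as [src] is
   a submersion, and it is unique. *)
Definition lie_groupoid G : Prop :=
  [/\ submersion (@src R G), submersion (@tgt R G),
      smooth (@gunit R G), smooth (@ginv R G) &
      exists P : submanifold (composable G),
        @smooth R P (arr G) (fun p => gmul (val p).1 (val p).2)].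

Record functor G H := Functor {
  fobj : obj G -> obj H;
  farr : arr G -> arr H;
  src_farr : forall g, src (farr g) = fobj (src g);
  tgt_farr : forall g, tgt (farr g) = fobj (tgt g);
  farr_unit : forall x, farr (gunit x) = gunit (fobj x);
  farr_mul : forall h g, src h = tgt g ->
    farr (gmul h g) = gmul (farr h) (farr g)
}.

Definition smooth_functor G H (F : functor G H) : Prop :=
  smooth (fobj F) /\ smooth (farr F).

Definition lie_isomorphism G H (F : functor G H) : Prop :=
  smooth_functor F /\
  exists F' : functor H G,
    [/\ smooth_functor F', cancel (fobj F) (fobj F'),
        cancel (fobj F') (fobj F), cancel (farr F) (farr F') &
        cancel (farr F') (farr F)].

Section Pullback.
Context (M : manifold R) (H : groupoid R) (f : M -> obj H).

(* The triples [(n, h, m)]. *)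
Definition pullback_arrows :
    set (prod_manifold (prod_manifold M (arr H)) M) :=
  [set a | tgt a.1.2 = f a.1.1 /\ src a.1.2 = f a.2].

Context (A : submanifold pullback_arrows).

Definition pullback_src (a : A) : M := (val a).2.
Definition pullback_tgt (a : A) : M := (val a).1.1.

Fact pullback_unit_subproof x :
  (x, gunit (f x), x) \in pullback_arrows.
Proof. by apply/mem_set; rewrite /pullback_arrows /= src_unit tgt_unit. Qed.
Definition pullback_unit (x : M) : A :=
  exist (fun a => a \in pullback_arrows) _ (pullback_unit_subproof x).

Fact pullback_inv_subproof (a : A) :
  ((val a).2, ginv (val a).1.2, (val a).1.1) \in pullback_arrows.
Proof.
apply/mem_set; have /set_mem[] := valP a.
by rewrite /pullback_arrows /= src_inv tgt_inv.
Qed.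
Definition pullback_inv (a : A) : A :=
  exist (fun a => a \in pullback_arrows) _ (pullback_inv_subproof a).

(* [insubd b x] is [x] when [x] belongs to [pullback_arrows], which is the case
   when [b] and [a] are composable. *)
Definition pullback_mul (b a : A) : A :=
  insubd b ((val b).1.1, gmul (val b).1.2 (val a).1.2, (val a).2).

Fact pullback_composable (b a : A) : pullback_src b = pullback_tgt a ->
  src (val b).1.2 = tgt (val a).1.2.
Proof.
have /set_mem[_ ->] := valP b; have /set_mem[-> _] := valP a.
by move=> ba; congr (f _); exact: ba.
Qed.

Fact val_pullback_mul (b a : A) : pullback_src b = pullback_tgt a ->
  val (pullback_mul b a) =
  ((val b).1.1, gmul (val b).1.2 (val a).1.2, (val a).2).
Proof.
move=> /pullback_composable ba; rewrite insubdK //; apply/mem_set.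
have /set_mem[tb _] := valP b; have /set_mem[_ sa] := valP a.
by split; rewrite /= ?tgt_mul ?src_mul.
Qed.

Fact pullback_src_mul (b a : A) : pullback_src b = pullback_tgt a ->
  pullback_src (pullback_mul b a) = pullback_src a.
Proof. by move=> ba; rewrite /pullback_src val_pullback_mul. Qed.

Fact pullback_tgt_mul (b a : A) : pullback_src b = pullback_tgt a ->
  pullback_tgt (pullback_mul b a) = pullback_tgt b.
Proof. by move=> ba; rewrite /pullback_tgt val_pullback_mul. Qed.

Fact pullback_mulA (c b a : A) :
  pullback_src c = pullback_tgt b -> pullback_src b = pullback_tgt a ->
  pullback_mul c (pullback_mul b a) = pullback_mul (pullback_mul c b) a.
Proof.
move=> cb ba; apply: val_inj.
have cba : pullback_src c = pullback_tgt (pullback_mul b a).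
  by rewrite pullback_tgt_mul.
have cba' : pullback_src (pullback_mul c b) = pullback_tgt a.
  by rewrite pullback_src_mul.
rewrite (val_pullback_mul cba) (val_pullback_mul cba').
rewrite (val_pullback_mul ba) (val_pullback_mul cb) /=.
rewrite gmulA //; [exact: pullback_composable cb|exact: pullback_composable ba].
Qed.

Fact pullback_mul1 (a : A) : pullback_mul a (pullback_unit (pullback_src a)) = a.
Proof.
case: a => -[[n h] m] a_in; apply: val_inj; rewrite val_pullback_mul //=.
have /set_mem[/= ta sa] := a_in.
by rewrite /pullback_src /= -sa gmul1.
Qed.

Fact pullback_mul_unit (a : A) :
  pullback_mul (pullback_unit (pullback_tgt a)) a = a.
Proof.
case: a => -[[n h] m] a_in; apply: val_inj; rewrite val_pullback_mul //=.
have /set_mem[/= ta sa] := a_in.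
by rewrite /pullback_tgt /= -ta gmul_unit.
Qed.

Fact pullback_mulV (a : A) :
  pullback_mul a (pullback_inv a) = pullback_unit (pullback_tgt a).
Proof.
case: a => -[[n h] m] a_in; apply: val_inj; rewrite val_pullback_mul //=.
have /set_mem[/= ta sa] := a_in.
by rewrite gmulV ta.
Qed.

Fact pullback_mulVl (a : A) :
  pullback_mul (pullback_inv a) a = pullback_unit (pullback_src a).
Proof.
case: a => -[[n h] m] a_in; apply: val_inj; rewrite val_pullback_mul //=.
have /set_mem[/= ta sa] := a_in.
by rewrite gmulVl sa.
Qed.

Definition pullback_groupoid : groupoid R :=
  @Groupoid R M A pullback_src pullback_tgt pullback_unit pullback_inv
    pullback_mul (fun=> erefl) (fun=> erefl) (fun=> erefl) (fun=> erefl)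
    pullback_src_mul pullback_tgt_mul pullback_mulA pullback_mul1
    pullback_mul_unit pullback_mulV pullback_mulVl.

End Pullback.

Section EssentialEquivalence.
Context (G H : groupoid R) (F : functor G H).

Section PullbackFunctor.
Context (A : submanifold (pullback_arrows (fobj F))).

Fact pullback_farr_subproof (g : arr G) :
  (tgt g, farr F g, src g) \in pullback_arrows (fobj F).
Proof. by apply/mem_set; split; rewrite /= ?tgt_farr ?src_farr. Qed.

Definition pullback_farr (g : arr G) : A :=
  exist (fun a => a \in pullback_arrows (fobj F)) _ (pullback_farr_subproof g).

Fact pullback_farr_unit (x : obj G) :
  pullback_farr (gunit x) = gunit (x : obj (pullback_groupoid A)).
Proof. by apply: val_inj; rewrite /= tgt_unit src_unit farr_unit. Qed.

Fact pullback_farr_mul (h g : arr G) : src h = tgt g ->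
  pullback_farr (gmul h g) = pullback_mul (pullback_farr h) (pullback_farr g).
Proof.
move=> hg; apply: val_inj; rewrite val_pullback_mul //=.
by rewrite tgt_mul // src_mul // farr_mul.
Qed.

(* The functor [(t, phi, s)], which is the identity on the base. *)
Definition pullback_functor : functor G (pullback_groupoid A) :=
  @Functor G (pullback_groupoid A) id pullback_farr
    (fun=> erefl) (fun=> erefl) pullback_farr_unit pullback_farr_mul.

End PullbackFunctor.

Definition essential_equivalence : Prop :=
  [/\ smooth_functor F,
      (exists P : submanifold (fibre_product (@src R H) (fobj F)),
        @surjective_submersion R P (obj H) (fun p => tgt (val p).1)) &
      (exists A : submanifold (pullback_arrows (fobj F)),
        lie_isomorphism (pullback_functor A))].

End EssentialEquivalence.

Definition morita_equivalent G H : Prop :=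
  exists K : groupoid R, lie_groupoid K /\
    (exists F : functor K G, essential_equivalence F) /\
    (exists F : functor K H, essential_equivalence F).

Section CompactGeneration.
Context (G : groupoid R).
Implicit Types S : set (arr G).

Definition generated S : set (arr G) :=
  smallest [set T | (forall h g, T h -> T g -> src h = tgt g -> T (gmul h g)) /\
                    (forall g, T g -> T (ginv g))] S.

Definition base S : set (obj G) := (@src R G) @` S `|` (@tgt R G) @` S.

Definition generates_full S : Prop :=
  forall g, base S (src g) -> base S (tgt g) -> generated S g.

Definition orbit (x : obj G) : set (obj G) :=
  (@tgt R G) @` ((@src R G) @^-1` [set x]).

Definition exhaustive S : Prop := forall x, base S `&` orbit x !=set0.

Definition relatively_compact (T : topologicalType) (U : set T) : Prop :=
  exists2 C : set T, cover_compact C & U `<=` C.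

Definition object_separated : Prop := hausdorff_space (obj G).

Definition compactly_generated : Prop :=
  exists U : set (arr G),
    [/\ open U, relatively_compact U, exhaustive U & generates_full U].

End CompactGeneration.

End LieGroupoids.

(* Main.v *)
From HB Require Import structures.
Require Import Defs.
From mathcomp Require Import all_boot all_order all_algebra.
From mathcomp Require Import all_classical all_reals all_analysis.
From mathcomp Require Import ring lra finmap.

Set Implicit Arguments.
Unset Strict Implicit.
Unset Printing Implicit Defensive.

Import Order.TTheory GRing.Theory Num.Theory.
Import numFieldNormedType.Exports.

Local Open Scope classical_set_scope.
Local Open Scope ring_scope.

(** The Morita equivalence provides essential equivalences [F1 : K -> G] and
    [F2 : K -> H]. Call bridge a triple [w = (g, k, h)] with [k] an object of [K],
    [g] an arrow of [G] starting at [F1 k] and [h] an arrow of [H] starting at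
    [F2 k]; it relates the object [tgt g] of [G] to the object [tgt h] of [H].
    Full faithfulness of [F1] and [F2] yields, for any two bridges [w] and [w'],
    a bijection between the arrows [tgt g -> tgt g'] of [G] and the arrows
    [tgt h -> tgt h'] of [H]. It respects products and inverses ([linked_mul],
    [linked_inv]) and depends continuously on the arrow and on the bridges
    ([cvg_transport]), because the isomorphisms with the pullback groupoids are
    homeomorphisms. Both maps [w |-> tgt g] and [w |-> tgt h] are open surjections
    ([bridge_open_tgt1], [bridge_open_tgt2], [bridge_surj]).

    Let [U] generate [G] compactly, with [U] contained in the compact set [C].
    Local compactness and openness give a compact set [D] of triples such that
    every object in the base of [U] is reached by a bridge in the interior of [D]
    ([bridge_compact_lift]). The open set sought in [H] consists of the arrows
    linked to arrows of [U] by two bridges in the interior of [D] over the base of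
    [U] ([transferred]). It is open as the bridges of an arrow can be moved along
    with its ends; it is contained in the continuous image of a closed subset of
    [D * C * D], closed because the bases of [G] and [H] are Hausdorff; it meets
    every orbit since [U] does; and it generates a full subgroupoid since a
    factorization in [G] of the arrow linked to [h] can be lifted, factor by
    factor, to a factorization of [h].

    The topological facts about manifolds behind this are local compactness and
    the openness of submersions ([submersion_open]). The latter rests on
    [C1_locally_onto], proved with the fixed point theorem for contractions. *)

(** * Local surjectivity of C^1 maps with onto differential *)

(** Matrices over a complete field form a complete normed module; the fixed
    point theorem for contractions needs this joint structure. *)
HB.instance Definition _ (R : realType) (m n : nat) :=
  Complete.on 'M[R]_(m, n).

Section LocalSurjectivity.
Context {R : realType}.

(** Row vectors carry the supremum norm. *)
Lemma coord_le_norm n (x : 'rV[R]_n) j : `|x ord0 j| <= `|x|.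
Proof.
rewrite [leRHS]/Num.Def.normr /= mx_normrE.
by apply: (le_bigmax _ (fun ij : 'I_1 * 'I_n => `|x ij.1 ij.2|) (ord0, j)).
Qed.

Lemma row_norm_le n (x : 'rV[R]_n) (e : R) :
  0 <= e -> (forall j, `|x ord0 j| <= e) -> `|x| <= e.
Proof.
move=> e0 xe; rewrite [leLHS]/Num.Def.normr /= mx_normrE; apply/bigmax_leP.
by split=> // -[i j] _ /=; rewrite (ord1 i).
Qed.

(** A linear map is bounded by the sum of the norms of the images of the
    standard basis. *)
Lemma norm_lin_row m n (L : {linear 'rV[R]_m -> 'rV[R]_n}) v :
  `|L v| <= `|v| * \sum_j `|L (delta_mx ord0 j)|.
Proof.
rewrite {1}(row_sum_delta v) linear_sum mulr_sumr.
apply: (le_trans (ler_norm_sum _ _ _)); apply: ler_sum => j _.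
by rewrite linearZ normrZ ler_wpM2r // coord_le_norm.
Qed.

Lemma segment_ball (V : normedModType R) (p x y : V) (r t : R) :
  ball p r x -> ball p r y -> 0 <= t <= 1 -> ball p r (x + t *: (y - x)).
Proof.
rewrite -ball_normE /ball_ /= => px py /andP[t0 t1].
have -> : p - (x + t *: (y - x)) = (1 - t) *: (p - x) + t *: (p - y).
  have -> : y - x = (p - x) - (p - y) by rewrite opprB [RHS]addrC addrA subrK.
  by rewrite scalerBl scale1r scalerBr opprD addrA opprB addrA addrAC.
apply: (le_lt_trans (ler_normD _ _)); rewrite !normrZ.
rewrite (ger0_norm t0) ger0_norm ?subr_ge0 //.
have [t_lt|] := ltP t 1; last first.
  move=> t1'; have -> : t = 1 by lra.
  rewrite subrr mul0r mul1r add0r; exact: py.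
apply: (@lt_le_trans _ _ ((1 - t) * r + t * r)); last first.
  by rewrite -mulrDl subrK mul1r.
apply: ltr_leD; first by rewrite ltr_pM2l // subr_gt0.
by rewrite ler_wpM2l // ltW.
Qed.

(** The mean value theorem along the segment from [x] to [x + v] holds for each
    coordinate separately, the intermediate point depending on the coordinate. *)
Lemma mean_value_coord m n (f : 'rV[R]_m -> 'rV[R]_n) (x v : 'rV[R]_m) i :
  (forall t : R, 0 <= t <= 1 -> differentiable f (x + t *: v)) ->
  exists2 t, 0 <= t <= 1 &
    (f (x + v) - f x) ord0 i = ('d f (x + t *: v) v) ord0 i.
Proof.
move=> df.
pose l : R -> 'rV[R]_m := cst x + ( *:%R^~ v).
have dl (t : R) : is_diff t l ( *:%R^~ v : R -> 'rV[R]_m).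
  have dc : is_diff t (cst x) (0 : R -> 'rV[R]_m) by exact: is_diff_cst.
  have dv : is_diff t ( *:%R^~ v : R -> 'rV[R]_m) ( *:%R^~ v : R -> 'rV[R]_m).
    exact: is_diff_scalel.
  apply: (is_diff_eq (is_diffD dc dv)).
  by apply/funext => s; rewrite !fctE add0r.
have dphi (t : R) : 0 <= t <= 1 ->
    is_derive t 1 (fun s => f (l s) ord0 i) (('d f (x + t *: v) v) ord0 i).
  move=> t01; have dft : differentiable f (l t) by exact: df.
  have dlt : differentiable l t by exact: ex_diff.
  have dfl : differentiable (f \o l) t.
    exact: differentiable_comp.
  have dflE : derivable (f \o l) t 1 by exact: diff_derivable.
  have /derivable_mxP dc := dflE.
  apply: DeriveDef; first exact: dc.
  transitivity ('D_1 (f \o l) t ord0 i).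
    by rewrite derive_mx // mxE.
  rewrite deriveE // diff_comp //.
  by rewrite /= diff_val scale1r.
have [||t t01] := @MVT_segment R (fun s => f (l s) ord0 i)
  (fun t => ('d f (x + t *: v) v) ord0 i) 0 1 ler01.
- by move=> t; rewrite in_itv /= => /andP[t0 t1]; apply: dphi; rewrite !ltW.
- apply/continuous_in_subspaceT => t /set_mem; rewrite /= in_itv => t01.
  apply: differentiable_continuous; apply/derivable1_diffP.
  by have [] := dphi t t01.
rewrite subr0 mulr1 /l !fctE scale1r scale0r addr0 => fE.
by exists t; [move: t01; rewrite in_itv|rewrite !mxE].
Qed.

(** A C^1 map is strictly differentiable: near [p] it differs from its
    differential at [p] by a map with an arbitrarily small Lipschitz constant. *)
Lemma C1_strict_diff m n (f : 'rV[R]_m -> 'rV[R]_n) (D : set 'rV[R]_m) p e :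
  open D -> D p -> Ck 1 D f -> 0 < e ->
  exists2 r, 0 < r & forall x y, ball p r x -> ball p r y ->
    `|f y - f x - 'd f p (y - x)| <= e * `|y - x|.
Proof.
move=> oD Dp [df cdf] e0.
have small : \forall z \near p, D z /\
    \sum_j `|'d f z (delta_mx ord0 j) - 'd f p (delta_mx ord0 j)| < e.
  pose S z := \sum_j `|'d f z (delta_mx ord0 j) - 'd f p (delta_mx ord0 j)|.
  have S0 : S p = 0 by rewrite /S big1 // => j _; rewrite subrr normr0.
  have cS : S z @[z --> p] --> S p.
    have cj j : `|'d f z (delta_mx ord0 j) - 'd f p (delta_mx ord0 j)| @[z --> p]
        --> `|'d f p (delta_mx ord0 j) - 'd f p (delta_mx ord0 j)|.
      have c1 : 'd f z (delta_mx ord0 j) @[z --> p] --> 'd f p (delta_mx ord0 j).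
        exact: (cdf (delta_mx ord0 j) p Dp).
      exact: (cvg_norm (cvgB c1 (cvg_cst _))).
    apply: cvg_big; first exact: add_continuous.
      exact: nbhs_filter.
    by move=> j _; exact: cj.
  near=> z; split; first by near: z; exact: open_nbhs_nbhs.
  have Sz : `|S p - S z| < e by near: z; apply: cvgr_dist_lt.
  by move: Sz; rewrite S0 sub0r normrN; apply: le_lt_trans; exact: ler_norm.
have /nbhs_ballP[r /= r0 rP] := small.
exists r => // x y px py.
apply: row_norm_le; first by rewrite mulr_ge0 // ltW.
move=> i.
have dfx t : 0 <= t <= 1 -> differentiable f (x + t *: (y - x)).
  by move=> t01; apply: df; have [] := rP _ (segment_ball px py t01).
have [t t01] := mean_value_coord i dfx.
rewrite (addrC x (y - x)) subrK => fE.
have [_ zE] := rP _ (segment_ball px py t01).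
set z := x + t *: (y - x) in fE zE.
have -> : (f y - f x - 'd f p (y - x)) ord0 i =
    (('d f z \- 'd f p) (y - x)) ord0 i.
  by rewrite [LHS]mxE fE [RHS]mxE.
apply: (le_trans (coord_le_norm _ _)).
apply: (le_trans (norm_lin_row _ _)).
by rewrite mulrC ler_wpM2r // ltW.
Unshelve. all: by end_near. Qed.

(** A C^1 map whose differential at [p] is onto maps neighbourhoods of [p] onto
    neighbourhoods of [f p]. With [L] a linear right inverse of the differential,
    the equation [f (p + L z) = y] is solved for [y] near [f p] by the fixed
    point of the contraction [z |-> y - (f (p + L z) - z)]. *)
Lemma C1_locally_onto m n (f : 'rV[R]_m -> 'rV[R]_n) (D : set 'rV[R]_m) p :
  open D -> D p -> Ck 1 D f -> (forall w, exists v, 'd f p v = w) ->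
  forall A, nbhs p A -> nbhs (f p) (f @` A).
Proof.
move=> oD Dp Cf surj A pA.
have [b bP] : exists b : 'I_n -> 'rV[R]_m,
    forall j, 'd f p (b j) = delta_mx ord0 j.
  exists (fun j => projT1 (cid (surj (delta_mx ord0 j)))) => j.
  exact: projT2 (cid (surj (delta_mx ord0 j))).
pose L := mulmxr (\matrix_j b j) : {linear 'rV[R]_n -> 'rV[R]_m}.
have dL z : 'd f p (L z) = z.
  rewrite /L /= mulmx_sum_row linear_sum [RHS]row_sum_delta.
  by apply: eq_bigr => j _; rewrite linearZ rowK bP.
pose M := 1 + \sum_j `|L (delta_mx ord0 j)|.
have M0 : 0 < M by rewrite ltr_pwDl // sumr_ge0.
have LM z : `|L z| <= M * `|z|.
  rewrite mulrC; apply: (le_trans (norm_lin_row _ _)).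
  by rewrite ler_wpM2l // lerDr.
(* As [L] is bounded by [M], this Lipschitz constant for the error term of [f]
   makes the error term of [z |-> f (p + L z)] a 1/2-contraction. *)
have eM : 0 < (2 * M)^-1 by rewrite invr_gt0 mulr_gt0.
have [r1 r10 fP] := C1_strict_diff oD Dp Cf eM.
have /nbhs_ballP[r2 /= r20 r2A] := pA.
pose r := Num.min r1 r2.
have r0 : 0 < r by rewrite lt_min r10.
pose rho := r / (2 * M).
have rho0 : 0 < rho by rewrite divr_gt0 // mulr_gt0.
have Lball z : `|z| <= rho -> ball p r (p + L z).
  move=> zr; rewrite -ball_normE /ball_ /= opprD addNKr normrN.
  apply: (le_lt_trans (LM z)).
  apply: (@le_lt_trans _ _ (r / 2)); last first.
    by rewrite ltr_pdivrMr // ltr_pMr // ltr1n.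
  apply: (le_trans (ler_wpM2l (ltW M0) zr)).
  by have -> : M * rho = r / 2 by rewrite /rho; field; rewrite gt_eqF.
have fL z z' : `|z| <= rho -> `|z'| <= rho ->
    `|f (p + L z) - f (p + L z') - (z - z')| <= 2^-1 * `|z - z'|.
  move=> zr z'r.
  have sub1 : ball p r `<=` ball p r1 by apply: le_ball; rewrite ge_min lexx.
  have := fP _ _ (sub1 _ (Lball _ z'r)) (sub1 _ (Lball _ zr)).
  rewrite opprD addrACA subrr add0r -linearB dL => /le_trans; apply.
  rewrite invfM -mulrA ler_wpM2l ?invr_ge0 //.
  by rewrite mulrC ler_pdivrMr // mulrC LM.
have rho20 : 0 < rho / 2 by rewrite divr_gt0.
apply: filterS (nbhsx_ballx (f p) _ rho20) => y.
rewrite -ball_normE /ball_ /= => yr.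
pose U : set 'rV[R]_n := closed_ball_ Num.norm 0 rho.
have UE z : U z = (`|z| <= rho) by rewrite /U /closed_ball_ /= sub0r normrN.
pose Psi z := y - (f (p + L z) - z).
have PsiU : {homo Psi : z / U z >-> U z}.
  move=> z; rewrite !UE => zr.
  have := fL z 0 zr; rewrite normr0 linear0 addr0 subr0 => /(_ (ltW rho0)) fz.
  have -> : Psi z = - (f p - y) - (f (p + L z) - f p - z).
    by rewrite /Psi !opprB (addrCA z (f p)) [RHS]addrA subrK.
  apply: (le_trans (ler_normB _ _)); rewrite normrN.
  rewrite [leRHS](splitr rho); apply: lerD; first exact: ltW.
  by apply: (le_trans fz); rewrite mulrC ler_wpM2r.
pose g := mkfun PsiU.
have cg : is_contraction g.
  exists (2^-1)%:nng; split=> /=; first by rewrite invf_lt1 // ltr1n.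
  move=> [z z'] [/=]; rewrite !UE => zr z'r.
  apply: le_trans (fL _ _ zr z'r).
  have -> : f (p + L z) - f (p + L z') - (z - z') =
      (f (p + L z) - z) - (f (p + L z') - z').
    by rewrite [in LHS]opprD [in RHS]opprD addrACA.
  have -> : g z - g z' = (f (p + L z') - z') - (f (p + L z) - z).
    by rewrite /g /= /Psi [in LHS]opprB [LHS]addrC addrA subrK.
  by rewrite distrC.
have cU : closed U by exact: closed_closed_ball_.
(* The fixed point equation says that [f (p + L z) = y]. *)
have [|z] := banach_fixed_point cg cU.
  by exists 0; rewrite UE normr0 ltW.
rewrite UE => zr zE; have {zE} /eqP : z = y - (f (p + L z) - z) by exact: zE.
rewrite opprB addrCA -{1}[z]addr0 (inj_eq (addrI z)) eq_sym subr_eq0.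
move=> /eqP yE.
exists (p + L z).
  by apply: r2A; apply: le_ball (Lball _ zr); rewrite ge_min lexx orbT.
exact: esym.
Qed.

End LocalSurjectivity.

(** * Compactness and subspaces *)

Section PointSet.

(** Compactness through covers agrees with compactness through filters in every
    topological space. When [A] has a point, that point serves to see [T] as a
    pointed space. *)
Lemma cover_compactP (T : topologicalType) (A : set T) :
  cover_compact A <-> compact A.
Proof.
have [->|/set0P[x Ax]] := eqVneq A set0.
  split=> _; first exact: compact0.
  by move=> I D f _ _; exists fset0.
pose pT : ptopologicalType := HB.pack (Topological.sort T) (isPointed.Build T x).
by have -> : compact A = cover_compact A := congr1 (@^~ A) (@compact_cover pT).
Qed.

(** A property of sets that holds for the empty set, passes to subsets and to
    binary unions, and holds for some neighbourhood of every point of the compact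
    set [C] holds for [C]: otherwise the sets [A] such that [C `\` A] has the
    property form a proper filter without cluster point in [C]. *)
Lemma compact_induction (T : topologicalType) (C : set T) (Q : set T -> Prop) :
  compact C -> Q set0 -> (forall A B, Q A -> Q B -> Q (A `|` B)) ->
  (forall A B, A `<=` B -> Q B -> Q A) ->
  (forall x, C x -> exists2 A, nbhs x A & Q A) -> Q C.
Proof.
move=> cC Q0 QU QS Qx; apply: contrapT => nQ.
pose F : set_system T := fun A => Q (C `\` A).
have FF : ProperFilter F.
  apply: Build_ProperFilter.
    by rewrite /F setD0.
  split.
  - by rewrite /F setDT.
  - by move=> A B FA FB; rewrite /F setDIr; apply: QU.
  - by move=> A B AB; apply: QS; exact: setDS.
have [|x [Cx clx]] := cC F FF; first by rewrite /F setDv.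
have [A xA QA] := Qx x Cx.
have FnA : F (~` A) by apply: QS QA => y [_ /contrapT].
by have [y []] := clx _ _ FnA xA.
Qed.

Lemma closed_coincidence (T S : topologicalType) (f g : T -> S) :
  hausdorff_space S -> continuous f -> continuous g ->
  closed [set x | f x = g x].
Proof.
move=> hS cf cg x clx; apply: hS => A B fA gB.
have /clx[y [fgy [yA yB]]] : nbhs x (f @^-1` A `&` g @^-1` B).
  by apply: filterI; [exact: cf|exact: cg].
by exists (f y); split => //; rewrite fgy.
Qed.

(** Continuity on a subset with the subspace topology, in terms of
    neighbourhoods in the ambient space. *)
Lemma set_type_continuous_nbhs (T S : topologicalType) (A : set T)
    (f : set_type A -> S) (x : set_type A) :
  {for x, continuous f} -> forall N, nbhs (f x) N ->
  exists2 V, nbhs (val x) V & forall y : set_type A, V (val y) -> N (f y).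
Proof.
move=> cf N /cf [_ [/= [] B oB <- Bx BN]].
by exists B; [exact: open_nbhs_nbhs|move=> y; exact: BN].
Qed.

Lemma set_type_nbhs (T : topologicalType) (A : set T) (x : set_type A) V :
  nbhs (val x) V -> nbhs x (val @^-1` V).
Proof. by move=> xV; exact: (@initial_continuous _ _ _ x V xV). Qed.

End PointSet.

Section PairCvg.
Context {T : Type} {Phi : set_system T} {X Y : topologicalType}.

Lemma cvg_pr1 (v : T -> X * Y) (v0 : X * Y) :
  v @ Phi --> v0 -> (v t).1 @[t --> Phi] --> v0.1.
Proof. by move=> cv; apply: (cvg_comp _ _ cv); exact: cvg_fst. Qed.

Lemma cvg_pr2 (v : T -> X * Y) (v0 : X * Y) :
  v @ Phi --> v0 -> (v t).2 @[t --> Phi] --> v0.2.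
Proof. by move=> cv; apply: (cvg_comp _ _ cv); exact: cvg_snd. Qed.

End PairCvg.

(** * Submersions and manifolds *)

Section Manifolds.
Context {R : realType}.

Lemma submersion_continuous (M N : manifold R) (f : M -> N) :
  submersion f -> continuous f.
Proof. by case=> -[]. Qed.

(** Submersions are open maps. *)
Lemma submersion_open (M N : manifold R) (f : M -> N) x A :
  submersion f -> nbhs x A -> nbhs (f x) (f @` A).
Proof.
move=> [[cf sf] df] xA.
have [c Mc cx] := atlas_cover (manifold_structure M) x.
have [d Nd dfx] := atlas_cover (manifold_structure N) (f x).
pose p := chart_map c x.
have invp : chart_inv c p = x by exact: chart_mapK.
have Dp : local_rep_dom c d f p by split; rewrite ?invp //; exact: chart_map_cod.
have oD : open (local_rep_dom c d f) by exact: open_local_rep_dom.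
have pA : nbhs p ((chart_inv c @^-1` A) `&` local_rep_dom c d f).
  apply: filterI; last exact: open_nbhs_nbhs.
  by apply: (chart_inv_continuous Dp.1); rewrite invp.
have := C1_locally_onto oD Dp (sf c d Mc Nd 1%N) (df c d x Mc Nd cx dfx) pA.
rewrite {1}/local_rep /= invp => /(chart_map_continuous dfx) nd0.
have {nd0} nd : nbhs (f x) (chart_map d @^-1`
    (local_rep c d f @` (chart_inv c @^-1` A `&` local_rep_dom c d f))).
  exact: nd0.
have nD : nbhs (f x) (chart_dom d).
  by apply: open_nbhs_nbhs; split=> //; exact: open_chart_dom.
apply: filterS (filterI nd nD) => y /= [[z [Az [cz dz]] zy] dy].
exists (chart_inv c z) => //.
by rewrite -(chart_mapK dy) -zy /local_rep /= chart_mapK.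
Qed.

(** The compact neighbourhood is the image of a closed ball under a chart; as
    manifolds need not be Hausdorff, it need not be closed. *)
Lemma manifold_locally_compact (M : manifold R) (x : M) :
  exists2 C, compact C & nbhs x C.
Proof.
have [c Mc cx] := atlas_cover (manifold_structure M) x.
pose p := chart_map c x.
have cp : chart_cod c p by exact: chart_map_cod.
have /nbhs_ballP[e /= e0 ec] : nbhs p (chart_cod c).
  by apply: open_nbhs_nbhs; split=> //; exact: open_chart_cod.
have e20 : 0 < e / 2 by rewrite divr_gt0.
pose B := closed_ball p (e / 2).
have Bc : B `<=` chart_cod c.
  apply: (subset_trans _ ec); apply: closed_ball_subset => //.
  by rewrite ltr_pdivrMr // ltr_pMr // ltr1n.
exists (chart_inv c @` B).
  apply: continuous_compact.
    apply: continuous_in_subspaceT => y /set_mem By.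
    exact/chart_inv_continuous/Bc.
  apply: bounded_closed_compact; last exact: closed_ball_closed.
  exists (`|p| + e / 2); split; first exact: num_real.
  move=> b /ltW leb y; rewrite /B closed_ballE // /closed_ball_ /= => py.
  apply: le_trans leb; rewrite -[y](subKr p).
  by apply: (le_trans (ler_normB _ _)); rewrite lerD2l.
have nB : nbhs p B.
  apply: filterS (nbhsx_ballx p _ e20); exact: subset_closed_ball.
have nD : nbhs x (chart_dom c).
  by apply: open_nbhs_nbhs; split=> //; exact: open_chart_dom.
apply: filterS (filterI nD (chart_map_continuous cx nB)) => y /= [cy By].
by exists (chart_map c y) => //; exact: chart_mapK.
Qed.

End Manifolds.

(** * Algebra and continuity in groupoids *)

Section GroupoidAlgebra.
Context {R : realType} (G : groupoid R).
Implicit Types (g h c : arr G).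

Lemma ginv_uniq h g : src h = tgt g -> gmul h g = gunit (src g) -> h = ginv g.
Proof.
move=> hg hgE; have gV : src g = tgt (ginv g) by rewrite tgt_inv.
rewrite -[LHS]gmul1 hg -gmulV gmulA // hgE.
by rewrite -tgt_inv gmul_unit.
Qed.

Lemma ginvK g : ginv (ginv g) = g.
Proof.
by apply/esym/ginv_uniq; rewrite ?tgt_inv // gmulV src_inv.
Qed.

Lemma ginvM h g : src h = tgt g -> ginv (gmul h g) = gmul (ginv g) (ginv h).
Proof.
move=> hg; apply/esym/ginv_uniq.
  by rewrite src_mul ?tgt_mul ?src_inv ?tgt_inv.
have hgV : src (ginv h) = tgt h by rewrite src_inv.
rewrite -gmulA ?tgt_mul ?src_inv ?tgt_inv //.
rewrite [gmul (ginv h) _]gmulA ?src_inv // gmulVl hg gmul_unit gmulVl.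
by rewrite src_mul.
Qed.

(** The arrow [g' c g^-1] from [tgt g] to [tgt g'], for [c] an arrow from [src g]
    to [src g']. *)
Definition gconj g' c g : arr G := gmul g' (gmul c (ginv g)).

Lemma src_gconj g' c g : src g' = tgt c -> src c = src g ->
  src (gconj g' c g) = tgt g.
Proof. by move=> gc cg; rewrite /gconj !src_mul ?tgt_mul ?tgt_inv ?src_inv. Qed.

Lemma tgt_gconj g' c g : src g' = tgt c -> src c = src g ->
  tgt (gconj g' c g) = tgt g'.
Proof. by move=> gc cg; rewrite /gconj !tgt_mul ?tgt_inv. Qed.

Lemma gconj_mul g'' c' g' c g :
  src g'' = tgt c' -> src c' = src g' -> tgt c = src g' -> src c = src g ->
  gmul (gconj g'' c' g') (gconj g' c g) = gconj g'' (gmul c' c) g.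
Proof.
move=> e1 e2 e3 e4; rewrite /gconj.
have e5 : src c' = tgt c by rewrite e2.
rewrite -gmulA ?src_mul ?tgt_mul ?tgt_inv ?src_inv //; congr (gmul g'' _).
rewrite -gmulA ?src_mul ?tgt_mul ?tgt_inv ?src_inv //.
rewrite [gmul (ginv g') _]gmulA ?src_mul ?tgt_mul ?tgt_inv ?src_inv //.
rewrite gmulVl -e3.
have <- : tgt (gmul c (ginv g)) = tgt c by rewrite tgt_mul ?tgt_inv.
by rewrite gmul_unit gmulA ?tgt_inv.
Qed.

Lemma gconj_inv g' c g : src g' = tgt c -> src c = src g ->
  ginv (gconj g' c g) = gconj g (ginv c) g'.
Proof.
move=> e1 e2; rewrite /gconj ginvM ?tgt_mul ?tgt_inv // ginvM ?tgt_inv //.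
by rewrite ginvK gmulA // ?src_inv ?tgt_inv.
Qed.

Lemma gconjK g' c g : src g' = tgt c -> src c = src g ->
  gconj (ginv g') (gconj g' c g) (ginv g) = c.
Proof.
move=> e1 e2; rewrite /gconj ginvK.
rewrite -(gmulA (h := gmul c (ginv g))) ?src_mul ?tgt_mul ?tgt_inv ?src_inv //.
rewrite -gmulA ?tgt_inv ?src_inv // gmulVl -e2 gmul1.
by rewrite gmulA ?src_inv // gmulVl e1 gmul_unit.
Qed.

Lemma gconjVK g' c g : src c = tgt g -> tgt c = tgt g' ->
  gconj g' (gconj (ginv g') c (ginv g)) g = c.
Proof.
move=> e1 e2; rewrite -{1}[g']ginvK -{2}[g]ginvK.
by apply: gconjK; rewrite src_inv.
Qed.

End GroupoidAlgebra.

Lemma farr_inv (R : realType) (K G : groupoid R) (F : functor K G) k :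
  farr F (ginv k) = ginv (farr F k).
Proof.
apply: ginv_uniq; first by rewrite src_farr tgt_farr src_inv.
by rewrite -farr_mul ?src_inv // gmulVl farr_unit src_farr.
Qed.

Section GroupoidConvergence.
Context {R : realType} {G : groupoid R} {T : Type} (Phi : set_system T).
Context {FPhi : Filter Phi}.
Hypothesis lieG : lie_groupoid G.

(** The multiplication is only continuous on the composable pairs, whence the
    condition that the pairs be eventually composable. *)
Lemma cvg_gmul (h g : T -> arr G) h0 g0 :
  src h0 = tgt g0 -> (\forall t \near Phi, src (h t) = tgt (g t)) ->
  h @ Phi --> h0 -> g @ Phi --> g0 ->
  gmul (h t) (g t) @[t --> Phi] --> gmul h0 g0.
Proof.
case: lieG => [_ _ _ _ [P [cmul _]]] e0 e ch cg N nN.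
have hg0 : (h0, g0) \in composable (G := G) by apply/mem_set.
have [V nV VN] := set_type_continuous_nbhs (cmul (SigSub hg0)) nN.
have nVt : \forall t \near Phi, V (h t, g t) by exact: (cvg_pair ch cg).
suff : \forall t \near Phi, N (gmul (h t) (g t)) by [].
apply: filterS2 e nVt => t et Vt.
have hgt : (h t, g t) \in composable (G := G) by apply/mem_set.
exact: VN (SigSub hgt) Vt.
Qed.

Lemma cvg_ginv (g : T -> arr G) g0 : g @ Phi --> g0 -> ginv (g t) @[t --> Phi] --> ginv g0.
Proof.
by move=> cg; have [_ _ _ [cV _] _] := lieG; exact: (cvg_comp _ _ cg (cV g0)).
Qed.

Lemma cvg_gconj (h c g : T -> arr G) h0 c0 g0 :
  src h0 = tgt c0 -> src c0 = src g0 ->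
  (\forall t \near Phi, src (h t) = tgt (c t) /\ src (c t) = src (g t)) ->
  h @ Phi --> h0 -> c @ Phi --> c0 -> g @ Phi --> g0 ->
  gconj (h t) (c t) (g t) @[t --> Phi] --> gconj h0 c0 g0.
Proof.
move=> hc0 cg0 hcg ch cc cg.
apply: cvg_gmul => //; first by rewrite tgt_mul ?tgt_inv.
  by apply: filterS hcg => t [? ?]; rewrite tgt_mul ?tgt_inv.
apply: cvg_gmul => //; first by rewrite tgt_inv.
  by apply: filterS hcg => t [? ?]; rewrite tgt_inv.
exact: cvg_ginv.
Qed.

End GroupoidConvergence.

Section Generated.
Context {R : realType} {G : groupoid R} (S : set (arr G)).

Lemma generated_mul h g : generated S h -> generated S g -> src h = tgt g ->
  generated S (gmul h g).
Proof.
move=> Sh Sg hg T TP; have [[Tmul _] _] := TP.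
by apply: Tmul => //; [exact: Sh|exact: Sg].
Qed.

Lemma generated_inv g : generated S g -> generated S (ginv g).
Proof. by move=> Sg T TP; have [[_ Tinv] _] := TP; apply: Tinv; exact: Sg. Qed.

End Generated.

(** * Essential equivalences *)

Section EssentialEquivalence.
Context {R : realType} {K G : groupoid R} (F : functor K G).
Hypothesis eF : essential_equivalence F.

(** The isomorphism [(t, F, s)] onto the pullback groupoid makes an arrow of [K]
    the same thing as its source, its target and its image; [ess_cvg] says that
    this identification holds for the topologies too. *)
Lemma ess_full n g m : tgt g = fobj F n -> src g = fobj F m ->
  exists k, [/\ tgt k = n, farr F k = g & src k = m].
Proof.
move=> tg sg; case: eF => _ _ [A [_ [F' [_ _ _ _ FK]]]].
have a_in : (n, g, m) \in pullback_arrows (fobj F) by apply/mem_set.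
exists (farr F' (SigSub a_in)).
by have /(congr1 val) /= [-> -> ->] := FK (SigSub a_in).
Qed.

Lemma ess_faithful k k' : tgt k = tgt k' -> farr F k = farr F k' ->
  src k = src k' -> k = k'.
Proof.
move=> et ef es; case: eF => _ _ [A [_ [F' [_ _ _ FK _]]]].
by apply: (can_inj FK); apply: val_inj; rewrite /= et ef es.
Qed.

Lemma ess_cvg (T : Type) (Phi : set_system T) (k : T -> arr K) k0 :
  Filter Phi ->
  tgt (k t) @[t --> Phi] --> tgt k0 ->
  farr F (k t) @[t --> Phi] --> farr F k0 ->
  src (k t) @[t --> Phi] --> src k0 -> k @ Phi --> k0.
Proof.
move=> FPhi ct cf cs; case: eF => _ _ [A [_ [F' [[_ [cF' _]] _ _ FK _]]]] N.
rewrite -{1}(FK k0).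
move=> /(set_type_continuous_nbhs (cF' (farr (pullback_functor A) k0)))[V nV VN].
have : \forall t \near Phi, V (tgt (k t), farr F (k t), src (k t)).
  exact: (cvg_pair (cvg_pair ct cf) cs).
apply: filterS => t Vt; have := VN (farr (pullback_functor A) (k t)) Vt.
by rewrite FK.
Qed.

Lemma ess_surj x : exists g k, src g = fobj F k /\ tgt g = x.
Proof.
case: eF => _ [P [_ sP]] _; have [[[g k] gk] <-] := sP x.
by exists g, k; split=> //; exact: set_mem gk.
Qed.

(** The map [(g, k) |-> tgt g] on the pairs with [src g = F k] is open, as it is a
    submersion on an embedded submanifold. *)
Lemma ess_open g0 k0 A B : src g0 = fobj F k0 -> nbhs g0 A -> nbhs k0 B ->
  nbhs (tgt g0)
    [set x | exists g k, [/\ A g, B k, src g = fobj F k & tgt g = x]].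
Proof.
move=> gk0 gA kB; case: eF => _ [P [sP _]] _.
have in0 : (g0, k0) \in fibre_product (@src R G) (fobj F) by apply/mem_set.
have nAB : nbhs (SigSub in0 : P) (val @^-1` (A `*` B)).
  by apply: set_type_nbhs; exists (A, B).
apply: filterS (submersion_open sP nAB) => x [[[g k] gk]] [/= Ag Bk] <-.
by exists g, k; split => //; exact: set_mem gk.
Qed.

(** The arrow of [K] from [m] to [n] over [g]; [gunit m] is a default value, used
    when there is none. *)
Definition ess_lift n g m : arr K :=
  xget (gunit m) [set k | [/\ tgt k = n, farr F k = g & src k = m]].

Lemma ess_liftP n g m : tgt g = fobj F n -> src g = fobj F m ->
  [/\ tgt (ess_lift n g m) = n, farr F (ess_lift n g m) = g &
      src (ess_lift n g m) = m].
Proof.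
move=> tg sg; have [k kP] := ess_full tg sg.
by rewrite /ess_lift; case: xgetP => [k' _ //|/(_ k)].
Qed.

End EssentialEquivalence.

(** * Transport of arrows between Morita-equivalent groupoids *)

Section Bridge.
Context {R : realType} {K G H : groupoid R}.
Context (F1 : functor K G) (F2 : functor K H).

Local Notation W := (arr G * obj K * arr H)%type.
Implicit Types w : W.

(** A bridge [w = (g, k, h)] consists of an object [k] of [K] and of arrows
    [g : F1 k -> tgt g] of [G] and [h : F2 k -> tgt h] of [H]. It relates the
    object [tgt g = tgt w.1.1] of [G] to the object [tgt h = tgt w.2] of [H]. *)
Definition bridge : set (arr G * obj K * arr H) :=
  [set w | src w.1.1 = fobj F1 w.1.2 /\ src w.2 = fobj F2 w.1.2].

(** Given bridges [w] and [w'], an arrow of [G] and an arrow of [H] between the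
    objects which these bridges relate are linked when both come from the same
    arrow [k] of [K]. *)
Definition linked w' w g h := exists k, [/\ src k = w.1.2, tgt k = w'.1.2,
  g = gconj w'.1.1 (farr F1 k) w.1.1 & h = gconj w'.2 (farr F2 k) w.2].

Lemma linked_ends w' w g h : bridge w' -> bridge w -> linked w' w g h ->
  [/\ src g = tgt w.1.1, tgt g = tgt w'.1.1,
      src h = tgt w.2 & tgt h = tgt w'.2].
Proof.
move=> [b1' b2'] [b1 b2] [k [sk tk -> ->]].
by rewrite !(src_gconj, tgt_gconj) // ?tgt_farr ?src_farr ?sk ?tk.
Qed.

Lemma linked_mul w'' w' w g' h' g h : bridge w'' -> bridge w' -> bridge w ->
  linked w'' w' g' h' -> linked w' w g h ->
  linked w'' w (gmul g' g) (gmul h' h).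
Proof.
move=> [a1 a2] [b1 b2] [c1 c2] [k' [sk' tk' -> ->]] [k [sk tk -> ->]].
have e : src k' = tgt k by rewrite sk' tk.
exists (gmul k' k); rewrite src_mul // tgt_mul //; split => //.
  by rewrite farr_mul // gconj_mul // ?src_farr ?tgt_farr ?sk ?tk ?sk' ?tk'.
by rewrite farr_mul // gconj_mul // ?src_farr ?tgt_farr ?sk ?tk ?sk' ?tk'.
Qed.

Lemma linked_inv w' w g h : bridge w' -> bridge w ->
  linked w' w g h -> linked w w' (ginv g) (ginv h).
Proof.
move=> [b1' b2'] [b1 b2] [k [sk tk -> ->]]; exists (ginv k).
rewrite src_inv tgt_inv !farr_inv; split => //.
  by rewrite gconj_inv // ?src_farr ?tgt_farr ?sk ?tk.
by rewrite gconj_inv // ?src_farr ?tgt_farr ?sk ?tk.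
Qed.

Hypothesis e1 : essential_equivalence F1.

Lemma linked_uniq w' w g h h' : bridge w' -> bridge w ->
  linked w' w g h -> linked w' w g h' -> h = h'.
Proof.
move=> [b1' b2'] [b1 b2] [k [sk tk gk ->]] [k' [sk' tk' gk' ->]].
suff -> : k = k' by [].
apply: (ess_faithful e1); rewrite ?tk ?tk' ?sk ?sk' //.
rewrite -(@gconjK _ _ w'.1.1 (farr F1 k) w.1.1) ?src_farr ?tgt_farr ?sk ?tk //.
by rewrite -gk gk' gconjK // ?src_farr ?tgt_farr ?sk' ?tk'.
Qed.

(** The arrow of [K] that links [g], an arrow of [G] from [tgt w.1.1] to
    [tgt w'.1.1], to an arrow of [H]. *)
Definition bridge_arrow w' w g : arr K :=
  ess_lift F1 w'.1.2 (gconj (ginv w'.1.1) g (ginv w.1.1)) w.1.2.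

Lemma bridge_arrowP w' w g : bridge w' -> bridge w ->
  src g = tgt w.1.1 -> tgt g = tgt w'.1.1 ->
  [/\ tgt (bridge_arrow w' w g) = w'.1.2,
      farr F1 (bridge_arrow w' w g) = gconj (ginv w'.1.1) g (ginv w.1.1) &
      src (bridge_arrow w' w g) = w.1.2].
Proof.
move=> [b1' _] [b1 _] sg tg; apply: ess_liftP => //.
  by rewrite tgt_gconj ?tgt_inv ?src_inv.
by rewrite src_gconj ?tgt_inv ?src_inv.
Qed.

(** The arrow of [H] linked to [g]. *)
Definition transport w' w g : arr H :=
  gconj w'.2 (farr F2 (bridge_arrow w' w g)) w.2.

Lemma transportP w' w g : bridge w' -> bridge w ->
  src g = tgt w.1.1 -> tgt g = tgt w'.1.1 -> linked w' w g (transport w' w g).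
Proof.
move=> bw' bw sg tg; have [tk fk sk] := bridge_arrowP bw' bw sg tg.
by exists (bridge_arrow w' w g); split => //; rewrite fk gconjVK.
Qed.

Hypotheses (lieG : lie_groupoid G) (lieH : lie_groupoid H).
Hypothesis e2 : essential_equivalence F2.

(** Transport is continuous in the arrow and in both bridges, as [ess_cvg] makes
    [bridge_arrow] continuous. *)
Lemma cvg_transport (T : Type) (Phi : set_system T) (w' w : T -> W)
    (g : T -> arr G) w0' w0 g0 :
  Filter Phi -> bridge w0' -> bridge w0 ->
  src g0 = tgt w0.1.1 -> tgt g0 = tgt w0'.1.1 ->
  (\forall t \near Phi, [/\ bridge (w' t), bridge (w t),
     src (g t) = tgt (w t).1.1 & tgt (g t) = tgt (w' t).1.1]) ->
  w' @ Phi --> w0' -> w @ Phi --> w0 -> g @ Phi --> g0 ->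
  transport (w' t) (w t) (g t) @[t --> Phi] --> transport w0' w0 g0.
Proof.
move=> FPhi bw0' bw0 sg0 tg0 near_ok cw' cw cg.
have [[_ [cF2 _]] _ _] := e2.
have [tk0 fk0 sk0] := bridge_arrowP bw0' bw0 sg0 tg0.
have ck : bridge_arrow (w' t) (w t) (g t) @[t --> Phi] -->
    bridge_arrow w0' w0 g0.
  apply: (ess_cvg e1).
  - rewrite tk0; apply: cvg_trans (cvg_pr2 (cvg_pr1 cw')).
    apply: near_eq_cvg; apply: filterS near_ok => t [b' b st tt].
    by have [-> _ _] := bridge_arrowP b' b st tt.
  - have cc : gconj (ginv (w' t).1.1) (g t) (ginv (w t).1.1) @[t --> Phi] -->
        gconj (ginv w0'.1.1) g0 (ginv w0.1.1).
      apply: cvg_gconj => //; rewrite ?src_inv //.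
      + by apply: filterS near_ok => t [b' b st tt]; rewrite !src_inv.
      + exact: (cvg_ginv lieG (cvg_pr1 (cvg_pr1 cw'))).
      + exact: (cvg_ginv lieG (cvg_pr1 (cvg_pr1 cw))).
    rewrite fk0; apply: cvg_trans cc.
    apply: near_eq_cvg; apply: filterS near_ok => t [b' b st tt].
    by have [_ -> _] := bridge_arrowP b' b st tt.
  - rewrite sk0; apply: cvg_trans (cvg_pr2 (cvg_pr1 cw)).
    apply: near_eq_cvg; apply: filterS near_ok => t [b' b st tt].
    by have [_ _ ->] := bridge_arrowP b' b st tt.
apply: cvg_gconj => //.
- by rewrite tgt_farr tk0 bw0'.2.
- by rewrite src_farr sk0 bw0.2.
- apply: filterS near_ok => t [b' b st tt].
  have [tk _ sk] := bridge_arrowP b' b st tt.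
  by rewrite tgt_farr src_farr tk sk b'.2 b.2.
- exact: (cvg_pr2 cw').
- exact: (cvg_comp _ _ ck (cF2 _)).
- exact: (cvg_pr2 cw).
Qed.

Lemma bridge_surj x : exists2 w, bridge w & tgt w.1.1 = x.
Proof.
have [g [k [gk gx]]] := ess_surj e1 x.
by exists (g, k, gunit (fobj F2 k)) => //; split => //=; rewrite src_unit.
Qed.

(** Forgetting [h] is open, being a base change of the open map [src], and the
    remaining map [(g, k) |-> tgt g] is open by [ess_open]. *)
Lemma bridge_open_tgt1 w A : bridge w -> nbhs w A ->
  nbhs (tgt w.1.1) ((fun v : W => tgt v.1.1) @` (bridge `&` A)).
Proof.
move=> [b1 b2] [[/= B C] [[[D E] [/= nD nE] DE] nC] BCA].
have [subH _ _ _ _] := lieH; have [[cF2 _] _ _] := e2.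
have nE' : nbhs w.1.2 (E `&` fobj F2 @^-1` (@src _ H @` C)).
  apply: filterI => //; apply: (cF2.1 w.1.2); rewrite -b2.
  exact: submersion_open subH nC.
apply: filterS (ess_open e1 b1 nD nE') => x [g [k [Dg [Ek [h Ch hk]] gk gx]]].
exists (g, k, h) => //; split=> //.
by apply: BCA; split => //=; exact: DE.
Qed.

End Bridge.

Section BridgeSymmetry.
Context {R : realType} {K G H : groupoid R}.
Context (F1 : functor K G) (F2 : functor K H).
Hypotheses (e1 : essential_equivalence F1) (e2 : essential_equivalence F2).
Hypotheses (lieG : lie_groupoid G) (lieH : lie_groupoid H).
Local Notation W := (arr G * obj K * arr H)%type.
Implicit Types w : W.

(** Bridges are symmetric in the two functors. *)
Definition swap w : (arr H * obj K * arr G)%type := (w.2, w.1.2, w.1.1).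

Lemma cvg_swap (T : Type) (Phi : set_system T) {FPhi : Filter Phi}
    (w : T -> W) (w0 : W) :
  w @ Phi --> w0 -> swap (w t) @[t --> Phi] --> swap w0.
Proof.
move=> cw; exact: (cvg_pair (cvg_pair (cvg_pr2 cw) (cvg_pr2 (cvg_pr1 cw)))
  (cvg_pr1 (cvg_pr1 cw))).
Qed.

Lemma bridge_swap w : bridge F2 F1 (swap w) <-> bridge F1 F2 w.
Proof. by split=> -[]. Qed.

Lemma linked_swap w' w g h :
  linked F2 F1 (swap w') (swap w) h g <-> linked F1 F2 w' w g h.
Proof. by split=> -[k [? ? ? ?]]; exists k. Qed.

Lemma bridge_open_tgt2 w A : bridge F1 F2 w -> nbhs w A ->
  nbhs (tgt w.2) ((fun v : W => tgt v.2) @` (bridge F1 F2 `&` A)).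
Proof.
move=> bw wA.
pose unswap (v : arr H * obj K * arr G) : W := (v.2, v.1.2, v.1.1).
have nA : nbhs (swap w) (unswap @^-1` A).
  have cu : unswap @ (swap w) --> unswap (swap w).
    have cid : id @ swap w --> swap w by exact: cvg_id.
    exact: (cvg_pair (cvg_pair (cvg_pr2 cid) (cvg_pr2 (cvg_pr1 cid)))
      (cvg_pr1 (cvg_pr1 cid))).
  apply: cu; by case: w wA {bw} => [[]].
have b : bridge F2 F1 (swap w) by case: bw.
have := bridge_open_tgt1 e2 lieG e1 b nA.
apply: filterS => x [v [[b1 b2] Av] <-].
by exists (unswap v).
Qed.

End BridgeSymmetry.

(** * The open set transferred along the bridges *)

Section Transfer.
Context {R : realType} {K G H : groupoid R}.
Context (F1 : functor K G) (F2 : functor K H).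
Hypotheses (e1 : essential_equivalence F1) (e2 : essential_equivalence F2).
Hypotheses (lieG : lie_groupoid G) (lieH : lie_groupoid H).
Hypotheses (sepG : object_separated G) (sepH : object_separated H).
Local Notation W := (arr G * obj K * arr H)%type.
Implicit Types w : W.
Variables (U C : set (arr G)) (D : set W).
Hypotheses (oU : open U) (cC : compact C) (UC : U `<=` C) (cD : compact D).
Hypothesis DC : forall x, base U x ->
  exists w, [/\ bridge F1 F2 w, D^° w & tgt w.1.1 = x].

(** The bridges that lie in the interior of the compact set [D] and start from the
    base of [U]. By [DC] they reach all of that base. *)
Definition bridge_core : set W :=
  [set w | [/\ bridge F1 F2 w, D^° w & base U (tgt w.1.1)]].

(** The arrows of [H] linked to arrows of [U] by bridges in [bridge_core]. *)
Definition transferred : set (arr H) :=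
  [set h | exists w' w g,
    [/\ bridge_core w', bridge_core w, U g & linked F1 F2 w' w g h]].

Lemma open_base : open (base U).
Proof.
have [subs subt _ _ _] := lieG.
have nU g : U g -> nbhs g U by move=> Ug; exact: open_nbhs_nbhs.
rewrite openE => x [|] [g Ug <-].
  apply: filterS (submersion_open subs (nU _ Ug)).
  by move=> y ?; left.
apply: filterS (submersion_open subt (nU _ Ug)).
by move=> y ?; right.
Qed.

Lemma bridge_core_near w : bridge_core w ->
  \forall v \near w, bridge F1 F2 v -> bridge_core v.
Proof.
have [_ subt _ _ _] := lieG; have ct := submersion_continuous subt.
move=> [bw Dw aw].
have n1 : \forall v \near w, D^° v.
  by apply: open_nbhs_nbhs; split => //; exact: open_interior.
have n2 : \forall v \near w, base U (tgt v.1.1).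
  have c1 : tgt v.1.1 @[v --> w] --> tgt w.1.1.
    have cid : id @ w --> w by exact: cvg_id.
    exact: (cvg_comp _ _ (cvg_pr1 (cvg_pr1 cid)) (ct _)).
  by apply: c1; apply: open_nbhs_nbhs; split => //; exact: open_base.
by apply: filterS2 n1 n2 => v Dv av bv; split.
Qed.

(** Let [h0] be linked to [g0] in [U] by [w0] and [w0']. An arrow [h] close to [h0]
    has its ends related to the base of [G] by bridges [w], [w'] close to [w0],
    [w0'], because [tgt w.2] is open in [w]; the arrow of [G] then linked to [h]
    is close to [g0], hence in [U]. *)
Lemma open_transferred : open transferred.
Proof.
rewrite openE => h0 [w0' [w0 [g0 [cw0' cw0 Ug0 l0]]]].
have [bw0' _ _] := cw0'; have [bw0 _ _] := cw0.
have [sg0 tg0 sh0 th0] := linked_ends bw0' bw0 l0.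
have [sH tH _ _ _] := lieH.
pose tr (t : W * arr H * W) := transport F2 F1 (swap t.1.1) (swap t.2) t.1.2.
pose compat : set (W * arr H * W) := [set t |
  [/\ bridge F1 F2 t.1.1, bridge F1 F2 t.2,
      src t.1.2 = tgt t.2.2 & tgt t.1.2 = tgt t.1.1.2]].
pose p0 : W * arr H * W := (w0', h0, w0).
have sb w : bridge F1 F2 w -> bridge F2 F1 (swap w).
  by move=> ?; exact/bridge_swap.
have tr0 : tr p0 = g0.
  have l1 : linked F2 F1 (swap w0') (swap w0) h0 (tr p0).
    by apply: transportP => //; exact: sb.
  have l2 : linked F2 F1 (swap w0') (swap w0) h0 g0 by exact/linked_swap.
  exact: (linked_uniq e2 (sb _ bw0') (sb _ bw0) l1 l2).
have cid : id @ within compat (nbhs p0) --> p0 by exact: cvg_within.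
have ctr : tr @ within compat (nbhs p0) --> tr p0.
  apply: (cvg_transport e2 lieH lieG e1) => //.
  - exact: sb.
  - exact: sb.
  - apply: filterS (@withinT _ (nbhs p0) compat _) => t [b' b st tt].
    by split => //; exact: sb.
  - exact: (cvg_swap (cvg_pr1 (cvg_pr1 cid))).
  - exact: (cvg_swap (cvg_pr2 cid)).
  - exact: (cvg_pr2 (cvg_pr1 cid)).
have : within compat (nbhs p0) (tr @^-1` U).
  by apply: ctr; rewrite tr0; apply: open_nbhs_nbhs.
move=> [[/= B A] [[[A' E] [/= nA' nE] BE] nA] BA].
have nAc : nbhs w0 (A `&` (fun v => bridge F1 F2 v -> bridge_core v)).
  by apply: filterI => //; exact: bridge_core_near.
have nAc' : nbhs w0' (A' `&` (fun v => bridge F1 F2 v -> bridge_core v)).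
  by apply: filterI => //; exact: bridge_core_near.
have nW := bridge_open_tgt2 e1 e2 lieG bw0 nAc.
have nW' := bridge_open_tgt2 e1 e2 lieG bw0' nAc'.
rewrite -sh0 in nW; rewrite -th0 in nW'.
have nS : \forall h \near h0, ((fun v : W => tgt v.2) @`
    (bridge F1 F2 `&` (A `&` (fun v => bridge F1 F2 v -> bridge_core v)))) (src h).
  exact: (@submersion_continuous _ _ _ _ sH h0 _ nW).
have nT : \forall h \near h0, ((fun v : W => tgt v.2) @`
    (bridge F1 F2 `&` (A' `&` (fun v => bridge F1 F2 v -> bridge_core v)))) (tgt h).
  exact: (@submersion_continuous _ _ _ _ tH h0 _ nW').
apply: filterS (filterI nE (filterI nS nT)) => h [Eh []].
move=> [w [bw [Aw cw]] wh] [w' [bw' [Aw' cw']] w'h].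
have {}cw := cw bw; have {}cw' := cw' bw'.
exists w', w, (tr (w', h, w)); split=> //.
  apply: (BA (w', h, w)) => //; split => //=.
  by apply: BE.
apply/linked_swap; apply: transportP => //; exact: sb.
Qed.

(* The triples [(w', g, w)] with [g] in [C] that can be transported. *)
Let Z : set (W * arr G * W) := (D `*` C `*` D) `&`
  [set t | [/\ bridge F1 F2 t.1.1, bridge F1 F2 t.2,
      src t.1.2 = tgt t.2.1.1 & tgt t.1.2 = tgt t.1.1.1.1]].

(** Both bases being Hausdorff, the conditions on the triples are closed. *)
Lemma compact_transfer_dom : compact Z.
Proof.
apply: compact_closedI; first by apply: compact_setX => //; exact: compact_setX.
have [sG tG _ _ _] := lieG; have [sH _ _ _ _] := lieH.
have cs := submersion_continuous sG; have ct := submersion_continuous tG.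
have csH := submersion_continuous sH.
have cF1 : continuous (fobj F1) by case: e1 => -[[]].
have cF2 : continuous (fobj F2) by case: e2 => -[[]].
have cid (t : W * arr G * W) : id @ t --> t by exact: cvg_id.
have cb (v : W * arr G * W -> W) :
    continuous v -> closed [set t | bridge F1 F2 (v t)].
  move=> cv.
  apply: (@closedI _ [set t | src (v t).1.1 = fobj F1 (v t).1.2]
                     [set t | src (v t).2 = fobj F2 (v t).1.2]).
    apply: closed_coincidence => // t.
      exact: (cvg_comp _ _ (cvg_pr1 (cvg_pr1 (cv t))) (cs _)).
    exact: (cvg_comp _ _ (cvg_pr2 (cvg_pr1 (cv t))) (cF1 _)).
  apply: closed_coincidence => // t.
    exact: (cvg_comp _ _ (cvg_pr2 (cv t)) (csH _)).
  exact: (cvg_comp _ _ (cvg_pr2 (cvg_pr1 (cv t))) (cF2 _)).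
rewrite (_ : mkset _ = [set t : W * arr G * W | bridge F1 F2 t.1.1] `&`
  [set t | bridge F1 F2 t.2] `&` [set t | src t.1.2 = tgt t.2.1.1] `&`
  [set t | tgt t.1.2 = tgt t.1.1.1.1]); last first.
  by apply/seteqP; split=> t; [case|move=> [[[]]]].
apply: closedI; first apply: closedI; first apply: closedI.
- by apply: cb => t; exact: (cvg_pr1 (cvg_pr1 (cid t))).
- by apply: cb => t; exact: (cvg_pr2 (cid t)).
- apply: closed_coincidence => // t.
    exact: (cvg_comp _ _ (cvg_pr2 (cvg_pr1 (cid t))) (cs _)).
  exact: (cvg_comp _ _ (cvg_pr1 (cvg_pr1 (cvg_pr2 (cid t)))) (ct _)).
apply: closed_coincidence => // t.
  exact: (cvg_comp _ _ (cvg_pr2 (cvg_pr1 (cid t))) (ct _)).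
exact: (cvg_comp _ _ (cvg_pr1 (cvg_pr1 (cvg_pr1 (cvg_pr1 (cid t))))) (ct _)).
Qed.

Lemma relatively_compact_transferred : relatively_compact transferred.
Proof.
pose tr (t : W * arr G * W) := transport F1 F2 t.1.1 t.2 t.1.2.
exists (tr @` Z).
  apply/cover_compactP.
  apply: continuous_compact; last exact: compact_transfer_dom.
  apply/subspace_continuousP => t Zt.
  have cid : id @ within Z (nbhs t) --> t by exact: cvg_within.
  have [_ [b' b st tt]] := Zt.
  apply: (cvg_transport e1 lieG lieH e2) => //.
  - by apply: filterS (@withinT _ (nbhs t) Z _) => u [].
  - exact: (cvg_pr1 (cvg_pr1 cid)).
  - exact: (cvg_pr2 cid).
  - exact: (cvg_pr2 (cvg_pr1 cid)).
move=> h [w' [w [g [[b' /interior_subset D' _] [b /interior_subset Dw _] Ug l]]]].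
have [sg tg _ _] := linked_ends b' b l.
exists (w', g, w); first by split => //; split => //; split => //; exact: UC.
by apply: (linked_uniq e1 b' b _ l); exact: transportP.
Qed.

Lemma bridge_core_lift x : base U x -> exists2 w, bridge_core w & tgt w.1.1 = x.
Proof.
move=> Ux; have [w [bw Dw wx]] := DC Ux.
by exists w => //; split; rewrite ?wx.
Qed.

Lemma base_transferred w : bridge_core w -> base transferred (tgt w.2).
Proof.
move=> cw; have [bw _ [] [g Ug gw]] := cw.
  have [|w' cw' w'g] := @bridge_core_lift (tgt g); first by right; exists g.
  have [bw' _ _] := cw'.
  have l := transportP e1 bw' bw gw (esym w'g).
  have [_ _ <- _] := linked_ends bw' bw l.
  by left; exists (transport F1 F2 w' w g) => //; exists w', w, g.
have [|w' cw' w'g] := @bridge_core_lift (src g); first by left; exists g.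
have [bw' _ _] := cw'.
have l := transportP e1 bw bw' (esym w'g) gw.
have [_ _ _ <-] := linked_ends bw bw' l.
by right; exists (transport F1 F2 w w' g) => //; exists w, w', g.
Qed.

Lemma base_transferredP y :
  base transferred y -> exists2 w, bridge_core w & tgt w.2 = y.
Proof.
move=> [] [h [w' [w [g [cw' cw Ug l]]]] <-];
  have [bw _ _] := cw; have [bw' _ _] := cw'.
  by have [_ _ -> _] := linked_ends bw' bw l; exists w.
by have [_ _ _ ->] := linked_ends bw' bw l; exists w'.
Qed.

Lemma exhaustive_transferred : exhaustive U -> exhaustive transferred.
Proof.
move=> exU y.
have [v bv vy] := bridge_surj F1 e2 y.
pose w : W := (v.2, v.1.2, v.1.1).
have bw : bridge F1 F2 w by case: bv.
have [x [Ux [g /= sg gx]]] := exU (tgt w.1.1).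
rewrite -{}gx in Ux.
have [w' cw' w'g] := bridge_core_lift Ux; have [bw' _ _] := cw'.
have [_ _ sh th] := linked_ends bw' bw (transportP e1 bw' bw sg (esym w'g)).
exists (tgt w'.2); split; first exact: base_transferred.
by exists (transport F1 F2 w' w g); rewrite //= sh.
Qed.

(** An arrow of [H] over the base of [transferred] is linked to an arrow of [G]
    over the base of [U], that is, to a product of arrows of [U] and of their
    inverses. The intermediate objects of that product lie in the base of [U]:
    bridges in [bridge_core] over them link its factors to arrows of
    [transferred] or their inverses. *)
Lemma generates_full_transferred :
  generates_full U -> generates_full transferred.
Proof.
move=> fullU h /base_transferredP[w cw wh] /base_transferredP[w' cw' w'h].
have [bw _ aw] := cw; have [bw' _ aw'] := cw'.
have [g l] : exists g, linked F1 F2 w' w g h.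
  exists (transport F2 F1 (swap w') (swap w) h); apply/linked_swap.
  by apply: transportP => //; exact/bridge_swap.
have [sg tg _ _] := linked_ends bw' bw l.
pose T : set (arr G) := [set g | [/\ base U (src g), base U (tgt g) &
  forall w w' h, bridge_core w -> bridge_core w' ->
    src g = tgt w.1.1 -> tgt g = tgt w'.1.1 ->
    linked F1 F2 w' w g h -> generated transferred h]].
suff : generated U `<=` T.
  move=> UT; have gU : generated U g by apply: fullU; rewrite ?sg ?tg.
  by have [_ _ /(_ w w' h cw cw' sg tg l)] := UT g gU.
apply: smallest_sub.
  split=> [g2 g1 [s2 t2 T2] [s1 t1 T1] e|g1 [s1 t1 T1]].
    split; rewrite ?src_mul ?tgt_mul // => v v' k cv cv' gv gv' lk.
    have [u cu ug] := bridge_core_lift t1.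
    have [bv _ _] := cv; have [bv' _ _] := cv'; have [bu _ _] := cu.
    have l1 := transportP e1 bu bv gv (esym ug).
    have l2 := transportP e1 bv' bu (etrans e (esym ug)) gv'.
    rewrite (linked_uniq e1 bv' bv lk (linked_mul bv' bu bv l2 l1)).
    have [_ _ _ tk1] := linked_ends bu bv l1.
    have [_ _ sk2 _] := linked_ends bv' bu l2.
    apply: generated_mul; last by rewrite sk2 tk1.
      exact: (T2 _ _ _ cu cv' (etrans e (esym ug)) gv' l2).
    exact: (T1 _ _ _ cv cu gv (esym ug) l1).
  split; rewrite ?src_inv ?tgt_inv // => v v' k cv cv' gv gv' lk.
  have [bv _ _] := cv; have [bv' _ _] := cv'.
  rewrite -[k]ginvK; apply: generated_inv.
  apply: (T1 v' v) => //.
  by rewrite -[g1]ginvK; exact: linked_inv.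
move=> g1 Ug1; split; [by left; exists g1|by right; exists g1|].
by move=> v v' k cv cv' _ _ lk; apply: sub_gen_smallest; exists v', v, g1.
Qed.

End Transfer.

Section CompactLift.
Context {R : realType} {K G H : groupoid R}.
Context (F1 : functor K G) (F2 : functor K H).
Hypotheses (e1 : essential_equivalence F1) (e2 : essential_equivalence F2).
Hypothesis lieH : lie_groupoid H.
Local Notation W := (arr G * obj K * arr H)%type.

Lemma triple_locally_compact (w : W) : exists2 D, compact D & nbhs w D.
Proof.
have [A cA nA] := manifold_locally_compact w.1.1.
have [B cB nB] := manifold_locally_compact w.1.2.
have [C cC nC] := manifold_locally_compact w.2.
exists (A `*` B `*` C); first by apply: compact_setX => //; exact: compact_setX.
by exists (A `*` B, C) => //; split => //; exists (A, B).
Qed.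

(** By local compactness of the space of triples and openness of
    [w |-> tgt w.1.1] on bridges. *)
Lemma bridge_compact_lift (C : set (obj G)) : compact C ->
  exists2 D : set W, compact D & forall x, C x ->
    exists w, [/\ bridge F1 F2 w, D^° w & tgt w.1.1 = x].
Proof.
move=> cC; pattern C.
apply: (compact_induction cC).
- by exists set0 => //; exact: compact0.
- move=> A B [D cD DA] [E cE EB]; exists (D `|` E); first exact: compactU.
  move=> x [/DA|/EB] [w [bw Dw wx]]; exists w; split => //.
    by apply: interiorS Dw => v; left.
  by apply: interiorS Dw => v; right.
- by move=> A B AB [D cD DB]; exists D => // x /AB; exact: DB.
- move=> x _; have [w bw <-] := bridge_surj F2 e1 x.
  have [D cD nD] := triple_locally_compact w.
  exists ((fun v : W => tgt v.1.1) @` (bridge F1 F2 `&` D^°)).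
    by apply: (bridge_open_tgt1 e1 lieH e2 bw); exact: nbhs_interior.
  by exists D => // y [v [bv Dv] vy]; exists v.
Qed.

End CompactLift.

Theorem theorem3p13 (R : realType) (G H : groupoid R)
  (lieG : lie_groupoid G) (lieH : lie_groupoid H)
  (sepG : object_separated G) (sepH : object_separated H)
  (GH : morita_equivalent G H) :
  compactly_generated G -> compactly_generated H.
Proof.
case: GH => K [_ [[F1 e1] [F2 e2]]].
move=> [U [oU [C /cover_compactP cC UC] exU fullU]].
have [subs subt _ _ _] := lieG.
have cbase : compact ((@src R G) @` C `|` (@tgt R G) @` C).
  by apply: compactU; apply: continuous_compact => //;
    apply: continuous_subspaceT; exact: submersion_continuous.
have [D cD CD] := bridge_compact_lift e1 e2 lieH cbase.
have UD x : base U x -> exists w, [/\ bridge F1 F2 w, D^° w & tgt w.1.1 = x].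
  by move=> Ux; apply: CD; case: Ux => -[g /UC Cg <-]; [left|right]; exists g.
exists (transferred F1 F2 U D); split.
- exact: open_transferred.
- exact: (relatively_compact_transferred e1 e2 lieG lieH sepG sepH cC UC cD).
- exact: (exhaustive_transferred e1 e2 UD exU).
- exact: (generates_full_transferred e1 e2 UD fullU).
Qed.
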